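(* Let $d\ge 3$ and let $F_1$ and $F_2$ be two isomorphic binary forms in $\mathrm{Bin}(d,\mathbb{Z})$. Then there is a positive constant $C_{F_1,F_2}$ such that, as $N\to\infty$, $$\mathcal{N}(F_1,F_2;N)\ge \left(C_{F_1,F_2}-o_{F_1,F_2}(1)\right)N^{2/d}.$$
   Context: For an integer $d\ge 3$, $\mathrm{Bin}(d,\mathbb{Z})$ is the set of binary forms $F(X,Y)$ of degree $d$ with integer coefficients and nonzero discriminant. For $\gamma=\begin{pmatrix} a_1 & a_2 \\ a_3 & a_4 \end{pmatrix}\in \mathrm{GL}(2,\mathbb{Q})$, put $(F\circ\gamma)(X_1,X_2)=F(a_1X_1+a_2X_2,\,a_3X_1+a_4X_2)$. Two forms $F_1,F_2\in \mathrm{Bin}(d,\mathbb{Z})$ are isomorphic if there is $\gamma\in\mathrm{GL}(2,\mathbb{Q})$ with $F_1\circ\gamma=F_2$. For an integer $N\ge1$, $$\mathcal{N}(F_1,F_2;N):=\sharp\left(F_1(\mathbb{Z}^2)\cap F_2(\mathbb{Z}^2)\cap[-N,N]\right).$$ *)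

(* Defs.v *)
From HB Require Import structures.
From mathcomp Require Import all_boot all_order all_algebra finmap.
From mathcomp Require Import all_classical all_reals all_analysis.
(* The notations of [mpoly] clash with those of MathComp-Analysis. *)
From mathcomp Require Import -(notations) mpoly.

Set Implicit Arguments.
Unset Strict Implicit.
Unset Printing Implicit Defensive.

Import Order.TTheory GRing.Theory Num.Theory.
Import numFieldNormedType.Exports.

Local Open Scope classical_set_scope.
Local Open Scope ring_scope.

(* X is the variable of index 0, Y the one of index 1. *)
Notation bpoly R := (mpoly 2 R).

(* d.-homog, a notation of [mpoly]; F = 0 is homogeneous of every degree. *)
Definition homogeneous (R : nzRingType) (d : nat) (F : bpoly R) : bool :=
  F \is ishomog1 d (@mdeg 2).

(* The coefficient of X^(n - k) Y^k, for k <= n. *)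
Definition form_coef (R : nzRingType) (n : nat) (F : bpoly R) (k : nat) : R :=
  mcoeff (Multinom [tuple (n - k)%N; k]) F.

(* For binary forms G and H of degrees m and n. Unlike for [mxpoly.Sylvester_mx]
   of the dehomogenized polynomials, the size of the matrix depends only on m
   and n, also when the coefficient of X^m or X^n vanishes. *)
Definition form_Sylvester (R : nzRingType) (m n : nat) (G H : bpoly R) :
    'M[R]_(n + m) :=
  let band k l (F : bpoly R) : 'M[R]_(l, n + m) :=
    \matrix_(i, j) if (i <= j <= i + k)%N then form_coef k F (j - i)%N else 0 in
  col_mx (band m n G) (band n m H).

Definition form_resultant (R : comNzRingType) (m n : nat) (G H : bpoly R) : R :=
  \det (form_Sylvester m n G H).

(* The discriminant of a binary form of degree d >= 2, that is,
   \prod_(i < j) (a_i b_j - a_j b_i)^2 if F = \prod_i (b_i X - a_i Y), given by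
     Res(dF/dX, dF/dY) = (-1)^(d (d - 1) / 2) d^(d - 2) disc(F). *)
Definition form_disc (d : nat) (F : bpoly int) : rat :=
  (-1) ^+ 'C(d, 2) / d%:R ^+ (d - 2)
  * (form_resultant d.-1 d.-1 (mderiv ord0 F) (mderiv ord_max F))%:~R.

Definition Bin_Z (d : nat) (F : bpoly int) : Prop :=
  homogeneous d F /\ form_disc d F != 0.

(* F(a1 X1 + a2 X2, a3 X1 + a4 X2) for g = (a1, a2; a3, a4). *)
Definition form_act (R : comNzRingType) (F : bpoly R) (g : 'M[R]_2) : bpoly R :=
  comp_mpoly [tuple \sum_(j < 2) g i j *: mpolyX R (mnm1 j) | i < 2] F.

Definition form_isomorphic (F1 F2 : bpoly int) : Prop :=
  exists2 g : 'M[rat]_2, g \in unitmx &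
    form_act (map_mpoly intr F1) g = map_mpoly intr F2.

(* F(Z^2) *)
Definition form_values (F : bpoly int) : set int :=
  range (fun v : 'I_2 -> int => meval v F).

Definition common_values (F1 F2 : bpoly int) (N : nat) : set int :=
  form_values F1 `&` form_values F2 `&` [set m | - N%:Z <= m <= N%:Z].

(* [fset_set] is junk on infinite sets. *)
Lemma finite_common_values (F1 F2 : bpoly int) (N : nat) :
  finite_set (common_values F1 F2 N).
Proof.
apply: (@sub_finite_set _ _
  ((fun k : nat => k%:Z - N%:Z) @` `I_(N + N).+1)); last first.
  exact/finite_image/finite_II.
move=> m [_ /= /andP[lo hi]]; have: 0 <= m + N%:Z by rewrite -lerBlDr sub0r.
case E: (m + N%:Z) => [k|//] _; exists k; last by rewrite -E addrK.
by rewrite /= ltnS -lez_nat -E PoszD lerD2r.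
Qed.

Definition num_common_values (F1 F2 : bpoly int) (N : nat) : nat :=
  #|` fset_set (common_values F1 F2 N)|%fset.

(* Main.v *)
(** The idea, after Erdos and Mahler, without any appeal to Thue's theorem.

    If F1 o gamma = F2 and D is a common denominator of gamma, then every D^d F2(x, y) is a common
    value.  Replacing F2 by F2(x, m x + a y) = a G(x, y) with a = F2(1, m) <> 0, it is enough to
    find >> N^(2/d) values of a monic form G whose dehomogenization g is separable, and there
    is an integer M > 0, divisible by 6, in the ideal (g, g') of Z[X].

    Put B = z^(20 d + 1) and let x = 1 (mod M) and y be coprime, of size B.  The values
    G(x, M y) are then prime to M and of size B^d.  For p not dividing M, a root of g modulo p
    has at most one lift modulo p^k, so p^k divides G(x, M y) for a proportion at most d / p^k
    of the x; since the product of p^(z/p) over p <= z is at most z!, the product of the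
    z-smooth parts of the values is at most z^(5 d #points).  Hence a positive proportion of
    the values have a z-smooth part less than z^(20 d) = B / z, and therefore a divisor
    q > z B^(d-1) >= z B^2 composed of boundedly many primes > z.  The value w being given, the
    residues of x / (M y) modulo the primes dividing q determine x / y modulo q, hence (x, y)
    itself, as x y' - x' y is smaller than q.  So each w is taken at boundedly many points. *)

Require Import Defs.
From mathcomp Require Import all_boot all_order all_algebra all_field.
From mathcomp Require Import all_classical all_reals all_analysis.
From mathcomp Require Import -(notations) mpoly.
From mathcomp Require Import ring lra zify.

Set Implicit Arguments.
Unset Strict Implicit.
Unset Printing Implicit Defensive.

Import Order.TTheory GRing.Theory Num.Theory.
Import numFieldNormedType.Exports.

Local Open Scope ring_scope.

(** * Reduction to a monic separable form *)

(** The coefficients form a bare sequence, so that the same formula can be evaluated over the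
    integers, ['F_p], [algC] and [{poly algC}], and so that changes of variables act on
    sequences. *)
Definition hform {R : comNzRingType} (n : nat) (c : nat -> R) (x y : R) : R :=
  \sum_(k < n.+1) c k * x ^+ (n - k) * y ^+ k.

Lemma hform_rmorph (R S : comNzRingType) (f : {rmorphism R -> S}) n c x y :
  f (hform n c x y) = hform n (f \o c) (f x) (f y).
Proof.
by rewrite rmorph_sum; apply: eq_bigr => k _; rewrite /= !rmorphM !rmorphXn.
Qed.

Lemma hform_scale (R : comNzRingType) n (c : nat -> R) t x y :
  hform n c (t * x) (t * y) = t ^+ n * hform n c x y.
Proof.
rewrite /hform mulr_sumr; apply: eq_bigr => k _.
have -> : t ^+ n = t ^+ (n - k) * t ^+ k by rewrite -exprD subnK // -ltnS.
by rewrite !exprMn; ring.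
Qed.

Lemma form_evalE (R : comNzRingType) d (F : bpoly R) (v : 'I_2 -> R) :
  homogeneous d F -> meval v F = hform d (form_coef d F) (v ord0) (v ord_max).
Proof.
move=> hF; rewrite mevalE.
pose m (k : nat) := Multinom [tuple (d - k)%N; k].
have mI (u : multinom 2) : mdeg u = d -> u = m (u ord_max).
  rewrite /m => <-; apply/mnmP => i; rewrite mdegE big_ord_recl big_ord1.
  have -> : lift ord0 ord0 = ord_max :> 'I_2 by apply/val_inj.
  rewrite multinomE (tnth_nth 0%N) /=; case: i => [[|[|//]] hi] /=.
    by rewrite addnK; congr (u _); apply/val_inj.
  by congr (u _); apply/val_inj.
have mK (k : nat) : m k ord_max = k by rewrite multinomE (tnth_nth 0%N).
have mX (k : nat) : \prod_i v i ^+ m k i = v ord0 ^+ (d - k) * v ord_max ^+ k.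
  rewrite big_ord_recl big_ord1 /m !multinomE !(tnth_nth 0%N) /=.
  by congr (_ * v _ ^+ _); apply/val_inj.
have degm (k : 'I_d.+1) : mdeg (m k) = d.
  by rewrite mdegE big_ord_recl big_ord1 /m !multinomE !(tnth_nth 0%N) /= subnK // -ltnS.
(* The support of [F] is exchanged for the list of all monomials of degree [d]; those outside the
   support contribute 0. *)
transitivity (\sum_(u <- [seq m k | k <- iota 0 d.+1]) mcoeff u F * \prod_i v i ^+ u i).
  apply: perm_big_supp; apply: uniq_perm.
  - exact/filter_uniq/msupp_uniq.
  - rewrite filter_uniq // map_inj_uniq ?iota_uniq // => k l kl.
    by rewrite -(mK k) kl mK.
  move=> u; rewrite !mem_filter; case: (mcoeff u F =P 0) => [->|/eqP u0].
    by rewrite mul0r eqxx.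
  have us : u \in msupp F by rewrite mcoeff_msupp.
  have du : mdeg u = d by exact: dhomog_mf hF _ us.
  rewrite us; congr (_ && _); symmetry; apply/mapP.
  exists (u ord_max); last exact: mI.
  by rewrite mem_iota /= add0n ltnS -du mdegE (bigD1 ord_max) //= leq_addr.
rewrite big_map -[iota 0 d.+1]/(index_iota 0 d.+1) big_mkord.
by apply: eq_bigr => k _; rewrite mX mulrA.
Qed.

(** Coefficients of dF/dX, and below of dF/dY, read as forms of degree one less than that of F. *)
Definition hform_dX {R : comNzRingType} (n : nat) (c : nat -> R) (k : nat) : R :=
  c k *+ (n - k).

Definition hform_dY {R : comNzRingType} (c : nat -> R) (k : nat) : R :=
  c k.+1 *+ k.+1.

Lemma form_coef_dX (R : comNzRingType) n (F : bpoly R) k : (k <= n)%N ->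
  form_coef n (mderiv ord0 F) k = hform_dX n.+1 (form_coef n.+1 F) k.
Proof.
move=> kn; rewrite /form_coef mcoeff_mderiv multinomE (tnth_nth 0%N) /= /hform_dX.
rewrite -subSn //; congr (mcoeff _ F *+ _).
apply/mnmP => i; rewrite mnmDE mnm1E !multinomE !(tnth_nth 0%N).
by case: i => [[|[|//]] hi] /=; rewrite ?addn0 ?addn1 // subSn.
Qed.

Lemma form_coef_dY (R : comNzRingType) n (F : bpoly R) k :
  form_coef n (mderiv ord_max F) k = hform_dY (form_coef n.+1 F) k.
Proof.
rewrite /form_coef mcoeff_mderiv multinomE (tnth_nth 0%N) /= /hform_dY.
rewrite /form_coef subSS; congr (mcoeff _ F *+ _).
apply/mnmP => i; rewrite mnmDE mnm1E !multinomE !(tnth_nth 0%N).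
by case: i => [[|[|//]] hi] /=; rewrite ?addn0 ?addn1.
Qed.

Lemma hform_euler (R : comNzRingType) n (c : nat -> R) x y :
  x * hform n (hform_dX n.+1 c) x y + y * hform n (hform_dY c) x y =
  n.+1%:R * hform n.+1 c x y.
Proof.
have -> : x * hform n (hform_dX n.+1 c) x y =
    \sum_(k < n.+2) (n.+1 - k)%:R * (c k * x ^+ (n.+1 - k) * y ^+ k).
  rewrite [RHS]big_ord_recr /= subnn mul0r addr0 mulr_sumr.
  apply: eq_bigr => k _; rewrite /hform_dX -mulr_natl.
  have -> : (n.+1 - k = (n - k).+1)%N by rewrite subSn // -ltnS.
  by rewrite exprS; ring.
have -> : y * hform n (hform_dY c) x y =
    \sum_(k < n.+2) k%:R * (c k * x ^+ (n.+1 - k) * y ^+ k).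
  rewrite [RHS]big_ord_recl /= mul0r add0r mulr_sumr.
  apply: eq_bigr => k _; rewrite /hform_dY -mulr_natl.
  by rewrite /bump /= add1n subSS exprS; ring.
rewrite -big_split /= mulr_sumr; apply: eq_bigr => k _.
by rewrite -mulrDl -natrD subnK // -ltnS.
Qed.

(** The chain rule for F(p, q). It turns a double root of a dehomogenized form into a relation
    between the partial derivatives. *)
Lemma hform_deriv (R : comNzRingType) n (c : nat -> R) (p q : {poly R}) :
  (hform n.+1 (polyC \o c) p q)^`() =
  hform n (polyC \o hform_dX n.+1 c) p q * p^`() +
  hform n (polyC \o hform_dY c) p q * q^`().
Proof.
rewrite /hform raddf_sum /=.
under eq_bigr => k _ do rewrite derivM derivM derivC mul0r add0r !deriv_exp.
rewrite big_split /=; congr (_ + _).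
  rewrite big_ord_recr /= subnn mulr0n mulr0 mul0r addr0 mulr_suml.
  apply: eq_bigr => k _; rewrite /hform_dX polyCMn -mulr_natl -[X in _ = X * _ * _ * _]mulr_natl.
  have -> : (n.+1 - k = (n - k).+1)%N by rewrite subSn // -ltnS.
  by rewrite /=; ring.
rewrite big_ord_recl /= mulr0n mulr0 add0r mulr_suml.
apply: eq_bigr => k _; rewrite /hform_dY polyCMn -mulr_natl -[X in _ = X * _ * _ * _]mulr_natl.
by rewrite /bump /= add1n subSS /=; ring.
Qed.

(** Each row holds the coefficients of a monomial times [G] or times [H]. Pairing it with the vector
    of all monomials of degree 2n + 1 in x, y evaluates that product. *)
Lemma form_Sylvester_mul (R : comNzRingType) n (G H : bpoly R) (x y : R) (i : 'I_(n.+1 + n.+1)) :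
  exists c : R, (form_Sylvester n.+1 n.+1 G H *m
    (\col_j (x ^+ (n.+1 + n.+1 - j.+1) * y ^+ j))) i ord0 =
   c * (if (i < n.+1)%N then hform n.+1 (form_coef n.+1 G) x y
        else hform n.+1 (form_coef n.+1 H) x y).
Proof.
have key (F : bpoly R) (l : 'I_n.+1) :
   \sum_(j < n.+1 + n.+1) (if (l <= j <= l + n.+1)%N then form_coef n.+1 F (j - l)%N else 0)
     * (x ^+ (n.+1 + n.+1 - j.+1) * y ^+ j) =
   x ^+ (n - l) * y ^+ l * hform n.+1 (form_coef n.+1 F) x y.
  have ln := ltn_ord l.
  rewrite -(big_mkord xpredT (fun j : nat =>
     (if (l <= j <= l + n.+1)%N then form_coef n.+1 F (j - l)%N else 0)
     * (x ^+ (n.+1 + n.+1 - j.+1) * y ^+ j))).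
  rewrite (@big_cat_nat _ _ _ l) //=; last by lia.
  rewrite (@big_cat_nat _ _ _ (l + n.+2)%N _ (n.+1 + n.+1)) //=; [|lia|lia].
  rewrite big_nat_cond big1 ?add0r; last first.
    move=> j /andP[/andP[_ jl] _]; rewrite leqNgt jl /= mul0r; by [].
  rewrite [X in _ + X]big_nat_cond [X in _ + X]big1 ?addr0; last first.
    move=> j /andP[/andP[jl _] _]; rewrite addnS in jl.
    by rewrite [(j <= _)%N]leqNgt jl andbF mul0r.
  rewrite -{1}(add0n (val l)) big_addn addKn big_mkord /hform mulr_sumr.
  apply: eq_bigr => k _; have kn := ltn_ord k.
  rewrite leq_addl addnK /= addnC leq_add2l -ltnS kn.
  have -> : (n.+1 + n.+1 - (l + k).+1 = (n - l) + (n.+1 - k))%N by lia.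
  by rewrite !exprD; ring.
case: (split_ordP i) => l ->.
  exists (x ^+ (n - l) * y ^+ l); rewrite mxE -key.
  by apply: eq_bigr => j _; rewrite col_mxEu !mxE.
exists (x ^+ (n - l) * y ^+ l); rewrite mxE -key.
by apply: eq_bigr => j _; rewrite col_mxEd !mxE.
Qed.

(** At a common zero the vector of monomials lies in the kernel of the Sylvester matrix. Its first
    and last entries are powers of x and of y, so it vanishes only at the origin. *)
Lemma form_resultant_neq0 (K : fieldType) n (G H : bpoly K) (x y : K) :
  hform n.+1 (form_coef n.+1 G) x y = 0 -> hform n.+1 (form_coef n.+1 H) x y = 0 ->
  form_resultant n.+1 n.+1 G H != 0 -> x = 0 /\ y = 0.
Proof.
move=> G0 H0; apply: contraNP => xy0.
pose v : 'cV[K]_(n.+1 + n.+1) := \col_j (x ^+ (n.+1 + n.+1 - j.+1) * y ^+ j).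
have v0 : v != 0.
  apply/eqP => /colP v0; apply: xy0; split.
    have := v0 ord0; rewrite !mxE mulr1 => /eqP.
    by rewrite expf_eq0 => /andP[_ /eqP].
  have := v0 ord_max; rewrite !mxE /= -addSn subnn mul1r => /eqP.
  by rewrite expf_eq0 => /andP[_ /eqP].
rewrite /form_resultant -det_tr; apply/det0P; exists v^T.
  by apply: contra_neq v0 => vT0; rewrite -[v]trmxK vT0 trmx0.
rewrite -trmx_mul; apply/rowP => i; rewrite !mxE.
have [c] := @form_Sylvester_mul _ n G H x y i.
by rewrite G0 H0 if_same mulr0 mxE.
Qed.

(** The coefficients of F(X, mX + Y). When k < j the truncated exponent [k - j] is harmless, as the
    binomial coefficient is 0. *)
Definition shear {R : comNzRingType} n (c : nat -> R) (m : R) (j : nat) : R :=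
  \sum_(k < n.+1) c k * m ^+ (k - j) *+ 'C(k, j).

Lemma shear0 (R : comNzRingType) n (c : nat -> R) (m : R) :
  shear n c m 0 = hform n c 1 m.
Proof. by apply: eq_bigr => k _; rewrite expr1n mulr1 bin0 mulr1n subn0. Qed.

Lemma shear_rmorph (R S : comNzRingType) (f : {rmorphism R -> S}) n c m :
  f \o shear n c m =1 shear n (f \o c) (f m).
Proof.
move=> j; rewrite /= rmorph_sum; apply: eq_bigr => k _.
by rewrite rmorphMn rmorphM rmorphXn.
Qed.

Lemma hform_shear (R : comNzRingType) n (c : nat -> R) (m x y : R) :
  hform n c x (m * x + y) = hform n (shear n c m) x y.
Proof.
rewrite /hform.
have expand (k : 'I_n.+1) : c k * x ^+ (n - k) * (m * x + y) ^+ k =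
   \sum_(j < n.+1) (c k * m ^+ (k - j) *+ 'C(k, j)) * x ^+ (n - j) * y ^+ j.
  rewrite exprDn mulr_sumr (big_ord_widen n.+1 (fun j => c k * x ^+ (n - k) *
    ((m * x) ^+ (k - j) * y ^+ j *+ 'C(k, j)))) // big_mkcond.
  apply: eq_bigr => j _; rewrite ltnS; case: leqP => [jk|kj].
    have -> : (n - j = (n - k) + (k - j))%N by have := ltn_ord k; lia.
    by rewrite exprD exprMn -!(mulrnAl, mulrnAr); ring.
  by rewrite bin_small // mulr0n !mul0r.
under eq_bigr => k _ do rewrite expand.
by rewrite exchange_big; apply: eq_bigr => j _; rewrite -!mulr_suml.
Qed.

(** This is F(X, 1): the index is reversed, which makes [c 0] the leading coefficient. *)
Definition dehom {R : nzRingType} (n : nat) (c : nat -> R) : {poly R} :=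
  \poly_(i < n.+1) c (n - i)%N.

Lemma dehomE (R : comNzRingType) n (c : nat -> R) :
  dehom n c = hform n (polyC \o c) 'X 1.
Proof.
rewrite /dehom poly_def (reindex_inj rev_ord_inj) /hform.
apply: eq_bigr => k _ /=; rewrite subSS subKn -1?ltnS //.
by rewrite expr1n mulr1 mul_polyC.
Qed.

Lemma horner_dehom (R : comNzRingType) n (c : nat -> R) t :
  (dehom n c).[t] = hform n c t 1.
Proof.
rewrite dehomE -[LHS]/(horner_eval t _) hform_rmorph /= /horner_eval hornerX.
rewrite hornerC; apply: eq_bigr => k _; by rewrite /= hornerC.
Qed.

Lemma map_dehom (R S : nzRingType) (f : {rmorphism R -> S}) n (c : nat -> R) :
  map_poly f (dehom n c) = dehom n (f \o c).
Proof.
apply/polyP => i; rewrite coef_map !coef_poly; case: ifP => // _; exact: rmorph0.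
Qed.

Lemma size_dehom (R : nzRingType) n (c : nat -> R) :
  c 0%N = 1 -> size (dehom n c) = n.+1.
Proof. by move=> c0; rewrite size_poly_eq //= subnn c0 oner_neq0. Qed.

Lemma dehom_monic (R : nzRingType) n (c : nat -> R) :
  c 0%N = 1 -> dehom n c \is monic.
Proof. by move=> c0; rewrite monicE lead_coef_poly ?subnn ?c0 ?oner_neq0. Qed.

Lemma form_values_hform d (F : bpoly int) x y :
  homogeneous d F -> form_values F (hform d (form_coef d F) x y).
Proof.
move=> hF; exists (fun i : 'I_2 => if i == ord0 then x else y) => //.
by rewrite (form_evalE _ hF).
Qed.

Lemma form_coef_map (R S : nzRingType) (f : {rmorphism R -> S}) n (F : bpoly R) :
  form_coef n (map_mpoly f F) =1 f \o form_coef n F.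
Proof. by move=> k; rewrite /form_coef mcoeff_map_mpoly. Qed.

Lemma form_resultant_map (R S : comNzRingType) (f : {rmorphism R -> S}) m n (G H : bpoly R) :
  form_resultant m n (map_mpoly f G) (map_mpoly f H) = f (form_resultant m n G H).
Proof.
rewrite /form_resultant -det_map_mx; congr (\det _).
apply/matrixP => i j; rewrite !mxE.
by case: splitP => k _; rewrite !mxE; case: ifP => _;
  rewrite ?form_coef_map ?rmorph0.
Qed.

Lemma eq_hform (R : comNzRingType) n (c c' : nat -> R) x y :
  (forall k, (k <= n)%N -> c k = c' k) -> hform n c x y = hform n c' x y.
Proof. by move=> cc'; apply: eq_bigr => k _; rewrite cc' // -ltnS. Qed.

(** Up to a rational factor the discriminant is the resultant of the two partial derivatives, and an
    injective [f] keeps that resultant nonzero. *)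
Lemma disc_gradient_neq0 n (F : bpoly int) (K : fieldType) (f : {rmorphism int -> K}) (x y : K) :
  injective f ->
  form_disc n.+2 F != 0 ->
  hform n.+1 (hform_dX n.+2 (f \o form_coef n.+2 F)) x y = 0 ->
  hform n.+1 (hform_dY (f \o form_coef n.+2 F)) x y = 0 ->
  x = 0 /\ y = 0.
Proof.
move=> fI hF FX0 FY0; apply: (@form_resultant_neq0 _ n
  (map_mpoly f (mderiv ord0 F)) (map_mpoly f (mderiv ord_max F))).
- rewrite -[RHS]FX0; apply: eq_hform => k kn.
  by rewrite form_coef_map /= form_coef_dX // /hform_dX rmorphMn.
- rewrite -[RHS]FY0; apply: eq_hform => k kn.
  by rewrite form_coef_map /= form_coef_dY /hform_dY rmorphMn.
rewrite form_resultant_map -(rmorph0 f) (inj_eq fI).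
by apply: contraNneq hF => res0; rewrite /form_disc res0 mulr0.
Qed.

Lemma hform_nonzero n (c : nat -> int) k : (k <= n)%N -> c k != 0 ->
  exists m, hform n c 1 m != 0.
Proof.
move=> kn ck; pose p := \poly_(i < n.+1) c i.
have p0 : p != 0.
  by apply: contra_neq ck => p0; have := coef_poly n.+1 c k; rewrite -/p p0 coef0 ltnS kn.
(* As a function of m the value is a nonzero polynomial [p], which cannot vanish at [size p]
   distinct integers. *)
pose rs := [seq Posz i | i <- iota 0 (size p)].
have : ~~ all (root p) rs.
  apply/negP => /(max_poly_roots p0); rewrite map_inj_uniq ?iota_uniq; last by move=> ? ? [].
  by rewrite size_map size_iota ltnn => /(_ isT).
case/allPn => m _ rm; exists m; rewrite /root in rm; apply: contra_neq rm => <-.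
rewrite horner_poly; apply: eq_bigr => i _.
by rewrite expr1n mulr1.
Qed.

(** In the application [b] lists the coefficients of F(X, mX + Y), and [hbc] says that F(X, mX + aY)
    = a G(X, Y), where G has the coefficients [c]. *)
Section Separability.
Variables (n : nat) (F : bpoly int) (m a : int) (b c : nat -> int).
Hypotheses (disc : form_disc n.+2 F != 0) (a0 : a != 0).
Hypothesis hbc : forall j, a * c j = b j * a ^+ j.
Hypothesis hb : forall x y : {poly algC},
  hform n.+2 (polyC \o intr \o form_coef n.+2 F) x (m%:~R * x + y) =
  hform n.+2 (polyC \o intr \o b) x y.

(** At the point (alpha, m alpha + a), a double root alpha gives F = 0 and FX + m FY = 0. Euler's
    identity then yields a FY = 0, so both partial derivatives vanish and the point is the origin,
    which contradicts a <> 0. *)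
Lemma separable_root (alpha : algC) :
  root (map_poly intr (dehom n.+2 c)) alpha ->
  ~~ root (map_poly intr (dehom n.+2 c)^`()) alpha.
Proof.
set C := intr \o form_coef n.+2 F : nat -> algC.
have aC0 : a%:~R != 0 :> algC by rewrite intr_eq0.
have polyE : a%:~R *: map_poly intr (dehom n.+2 c) =
    hform n.+2 (polyC \o C) 'X (m%:~R *: 'X + (a%:~R)%:P).
  rewrite map_dehom dehomE -[m%:~R *: _]mul_polyC rmorph_int [RHS]hb.
  rewrite /hform scaler_sumr; apply: eq_bigr => j _.
  rewrite expr1n mulr1 /= scalerAl -mul_polyC -polyCM -intrM hbc intrM polyCM.
  by rewrite rmorphXn /= polyC_exp; ring.
rewrite -deriv_map; set g := map_poly _ _ in polyE *.
move=> g0; apply/negP => g'0.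
have evalC k (D : nat -> algC) : (hform k (polyC \o D) 'X (m%:~R *: 'X + (a%:~R)%:P)).[alpha] =
    hform k D alpha (m%:~R * alpha + a%:~R).
  rewrite -[LHS]/(horner_eval alpha _) hform_rmorph /= /horner_eval !hornerE.
  by apply: eq_hform => i _; rewrite /= hornerC.
have F0 : hform n.+2 C alpha (m%:~R * alpha + a%:~R) = 0.
  by rewrite -evalC -polyE hornerZ (rootP g0) mulr0.
have dF0 : hform n.+1 (hform_dX n.+2 C) alpha (m%:~R * alpha + a%:~R) +
           hform n.+1 (hform_dY C) alpha (m%:~R * alpha + a%:~R) * m%:~R = 0.
  have := congr1 (fun p => (p^`()).[alpha]) polyE.
  rewrite /= derivZ hornerZ (rootP g'0) mulr0 hform_deriv => /esym.
  by rewrite derivD derivZ derivX derivC addr0 mulr1 hornerD hornerM !evalC hornerZ hornerC mulr1.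
have := hform_euler n.+1 C alpha (m%:~R * alpha + a%:~R).
rewrite F0 mulr0; set FX := hform _ (hform_dX _ _) _ _ in dF0 *.
set FY := hform _ (hform_dY _) _ _ in dF0 * => euler.
have /eqP : FY * a%:~R = 0.
  rewrite -euler; transitivity (FY * a%:~R + alpha * (FX + FY * m%:~R)).
    by rewrite dF0 mulr0 addr0.
  by ring.
rewrite mulf_eq0 (negPf aC0) orbF => /eqP FY0.
have FX0 : FX = 0 by move: dF0; rewrite FY0 mul0r addr0.
have intrI : injective (intr : int -> algC) by apply: intr_inj.
have [alpha0] := disc_gradient_neq0 intrI disc FX0 FY0.
by rewrite alpha0 mulr0 add0r => /eqP; rewrite (negPf aC0).
Qed.

End Separability.

Lemma common_denominator m n (g : 'M[rat]_(m, n)) :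
  exists2 D : int, D != 0 &
    exists w : 'M[int]_(m, n), forall i j, (w i j)%:~R = D%:~R * g i j.
Proof.
exists (\prod_ij denq (g ij.1 ij.2)).
  by apply/prodf_neq0 => ij _; exact: denq_neq0.
exists (\matrix_(i, j) (numq (g i j) * \prod_(kl | kl != (i, j)) denq (g kl.1 kl.2))).
move=> i j; rewrite mxE (bigD1 (i, j) isT) !intrM numqE /=.
by ring.
Qed.

(** If D clears the denominators of the matrix g, homogeneity gives D^d F2(x, y) = F2(Dx, Dy) = F1(D
    g (x, y)), with integral arguments on both sides. *)
Lemma values_iso d (F1 F2 : bpoly int) :
  homogeneous d F1 -> homogeneous d F2 -> form_isomorphic F1 F2 ->
  exists2 D : int, D != 0 & forall x y,
    (form_values F1 `&` form_values F2)%classic (D ^+ d * hform d (form_coef d F2) x y).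
Proof.
move=> h1 h2 [g _ gF]; have [D D0 [w wE]] := common_denominator g.
exists D; [exact: D0 | move=> x y; split; last first].
  by rewrite -hform_scale; exact: form_values_hform.
have -> : D ^+ d * hform d (form_coef d F2) x y =
   hform d (form_coef d F1) (w ord0 ord0 * x + w ord0 ord_max * y)
     (w ord_max ord0 * x + w ord_max ord_max * y).
  apply: (@intr_inj rat); rewrite intrM rmorphXn /= !hform_rmorph /=.
  have hmap (F : bpoly int) : homogeneous d F -> homogeneous d (map_mpoly (intr : int -> rat) F).
    move=> hF; apply/dhomogP => u; rewrite mcoeff_msupp mcoeff_map_mpoly intr_eq0 -mcoeff_msupp.
    exact: dhomog_mf hF u.
  have evalQ (F : bpoly int) s t : homogeneous d F ->
      hform d (intr \o form_coef d F) s t =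
      meval (fun i : 'I_2 => if i == ord0 then s else t) (map_mpoly intr F) :> rat.
    move=> hF; rewrite (form_evalE _ (hmap _ hF)) /=.
    by apply: eq_hform => k _; rewrite form_coef_map.
  rewrite (evalQ F2 _ _ h2) -gF /form_act comp_mpoly_meval.
  rewrite (form_evalE _ (hmap _ h1)) -hform_scale !tnth_mktuple.
  rewrite !raddf_sum /= !big_ord_recl !big_ord0 /= !mevalZ !mevalXU /= !addr0.
  have -> : lift ord0 ord0 = ord_max :> 'I_2 by apply/val_inj.
  rewrite !rmorphD /= !intrM !wE.
  rewrite [LHS](@eq_hform _ _ _ (intr \o form_coef d F1)); last first.
    by move=> k _; rewrite form_coef_map.
  by congr (hform _ _ _ _); ring.
exact: form_values_hform.
Qed.

Lemma form_reduction n (F1 F2 : bpoly int) :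
  Bin_Z n.+2 F1 -> Bin_Z n.+2 F2 -> form_isomorphic F1 F2 ->
  exists (c : nat -> int) (a M : int) (u v : {poly int}),
    [/\ c 0%N = 1, a != 0, M != 0,
      u * dehom n.+2 c + v * (dehom n.+2 c)^`() = M%:P &
      forall x y, (form_values F1 `&` form_values F2)%classic (a * hform n.+2 c x y)].
Proof.
move=> [h1 _] [h2 disc2] /(values_iso h1 h2)[D D0 DF].
set C := form_coef n.+2 F2 in DF.
have [m am0] : exists m, hform n.+2 C 1 m != 0.
  have [k kn Ck] : exists2 k, (k <= n.+2)%N & C k != 0.
    apply: contrapT => C0.
    have {}C0 k : (k <= n.+2)%N -> C k = 0.
      by move=> kn; apply/eqP/negPn/negP => Ck; apply: C0; exists k.
    have intrI : injective (intr : int -> rat) by apply: intr_inj.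
    have [] := @disc_gradient_neq0 n F2 _ intr 1 0 intrI disc2.
    - rewrite /hform big1 // => k _; rewrite /hform_dX /= -/C C0 ?mul0rn ?mul0r //.
      by have := ltn_ord k; lia.
    - rewrite /hform big1 // => k _; rewrite /hform_dY /= -/C C0 ?mul0rn ?mul0r //.
    by move/eqP; rewrite oner_eq0.
  exact: hform_nonzero kn Ck.
set a := hform n.+2 C 1 m in am0; pose b := shear n.+2 C m.
(* Since b_0 = F2(1, m) = a, every coefficient b_j a^j of F2(X, mX + aY) is divisible by a; the
   quotient has leading coefficient 1. *)
pose c j := if j is j'.+1 then b j * a ^+ j' else 1.
have hbc j : a * c j = b j * a ^+ j.
  case: j => [|j] /=; first by rewrite /b shear0 expr0.
  by rewrite exprS; ring.
have [] := @resultant_in_ideal _ (dehom n.+2 c) (dehom n.+2 c)^`().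
- by rewrite size_dehom.
- rewrite ltnNge; apply/negP => /leq_sizeP/(_ n.+1 isT)/eqP.
  by rewrite coef_deriv coef_poly ltnSn subnn /= pnatr_eq0.
move=> [u v] _ /= uvE.
exists c, (D ^+ n.+2 * a), (resultant (dehom n.+2 c) (dehom n.+2 c)^`()), u, v.
split => //.
- by rewrite mulf_neq0 // expf_neq0.
(* If the resultant vanished, the gcd of the polynomial and its derivative would have a root in
   [algC], which [separable_root] excludes. *)
- rewrite resultant_eq0 -leqNgt leqNgt; apply/negP => sr.
  set r := gcdp _ _ in sr.
  have /closed_rootP[alpha ra] : size (map_poly (intr : int -> algC) r) != 1%N.
    rewrite size_map_inj_poly ?rmorph0 //; last exact: intr_inj.
    by rewrite gtn_eqF.
  have rootr (p : {poly int}) : r %| p -> root (map_poly intr p) alpha.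
    case/Pdiv.Idomain.dvdpP => [[k q] /= k0 kp].
    have /eqP := congr1 (fun p : {poly int} => (map_poly intr p).[alpha]) kp.
    rewrite /= map_polyZ rmorphM /= hornerZ hornerM (rootP ra) mulr0 mulf_eq0.
    by rewrite intr_eq0 (negPf k0) /= => ?; apply/rootP/eqP.
  have hb (x y : {poly algC}) : hform n.+2 (polyC \o intr \o C) x (m%:~R * x + y) =
      hform n.+2 (polyC \o intr \o b) x y.
    rewrite hform_shear; apply: eq_hform => k _.
    have := shear_rmorph (polyC \o intr : {rmorphism int -> {poly algC}}) n.+2 C m k.
    by rewrite /= => ->; rewrite rmorph_int.
  have := separable_root disc2 am0 hbc hb (rootr _ (dvdp_gcdl _ _)).
  by rewrite (rootr _ (dvdp_gcdr _ _)).
move=> x y; rewrite -mulrA.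
suff -> : a * hform n.+2 c x y = hform n.+2 C x (m * x + a * y) by exact: DF.
rewrite hform_shear /hform mulr_sumr; apply: eq_bigr => k _.
by rewrite exprMn !mulrA hbc -/b; congr (_ * _); rewrite mulrAC.
Qed.

(** * Root classes modulo prime powers *)

Lemma card_le_fibres (T : finType) (rT : eqType) (f : T -> rT) (S : {set T}) m :
  (forall v, #|[set s in S | f s == v]| <= m)%N ->
  (#|S| <= size (undup [seq f s | s in S]) * m)%N.
Proof.
move=> fib; set I := undup _.
have -> : #|S| = (\sum_(v <- I) #|[set s in S | f s == v]|)%N.
  under eq_bigr => v _ do rewrite -sum1dep_card big_mkcondr.
  rewrite exchange_big -sum1_card; apply: eq_bigr => s sS /=.
  under eq_bigr => v _ do rewrite eq_sym.
  rewrite -big_mkcond sum1_count -/(count_mem _ _) count_uniq_mem ?undup_uniq //.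
  by rewrite mem_undup fintype.image_f.
rewrite -sum1_size big_distrl /=; apply: leq_sum => v _; rewrite mul1n; exact: fib.
Qed.

(** Induction on the list, splitting [S] into the fibres of the first map. It is meant for points
    determined by their root classes modulo several primes, each class being one of at most [d]
    roots. *)
Lemma card_le_prod_fibres (T : finType) (rT : nat -> eqType)
    (f : forall i, T -> rT i) d (l : seq nat) (S : {set T}) :
  (forall i, i \in l -> size (undup [seq f i s | s in S]) <= d)%N ->
  {in S &, forall s t, (forall i, i \in l -> f i s = f i t) -> s = t} ->
  (#|S| <= d ^ size l)%N.
Proof.
elim: l S => [|i l IH] S im inj /=.
  by apply/card_le1_eqP => s t sS tS; apply: inj.
rewrite expnS; apply: leq_trans (card_le_fibres (f := f i) (m := d ^ size l) _) _.
  move=> v; apply: IH => [j jl|s t].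
    apply: leq_trans (im j _); last by rewrite inE jl orbT.
    apply: uniq_leq_size (undup_uniq _) _ => w; rewrite !mem_undup.
    case/fintype.imageP => s; rewrite inE => /andP[sS _] ->; exact: fintype.image_f.
  rewrite !inE => /andP[sS /eqP fs] /andP[tS /eqP ft] fst.
  by apply: inj => // j; rewrite inE => /predU1P[->|/fst //]; rewrite fs ft.
by rewrite leq_mul2r im ?orbT // inE eqxx.
Qed.

Lemma size_image_roots (T : finType) (K : idomainType) (p : {poly K}) (f : T -> K) (S : {set T}) :
  p != 0 -> {in S, forall s, root p (f s)} ->
  (size (undup [seq f s | s in S]) <= (size p).-1)%N.
Proof.
move=> p0 rt; rewrite -ltnS prednK ?lt0n ?size_poly_eq0 //.
apply: max_poly_roots p0 _ (undup_uniq _); apply/allP => v.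
by rewrite mem_undup => /fintype.imageP[s /rt + ->].
Qed.

Lemma horner_taylor1 (R : comNzRingType) (p : {poly R}) a b :
  exists w, p.[a] - p.[b] = (a - b) * (p^`().[b] + (a - b) * w).
Proof.
elim/poly_ind: p => [|p c [w IH]]; first by exists 0; rewrite deriv0 !horner0; ring.
exists (p^`().[b] + a * w); rewrite derivD derivM derivX derivC !hornerE.
have -> : p.[a] = p.[b] + (a - b) * (p^`().[b] + (a - b) * w) by rewrite -IH; ring.
by ring.
Qed.

Lemma dvdz_hform_sub d (c : nat -> int) m x x' y :
  (m %| x - x')%Z -> (m %| hform d c x y - hform d c x' y)%Z.
Proof.
move=> mx; rewrite /hform -sumrB; apply: rpred_sum => k _.
rewrite -mulrBl -mulrBr subrXX.
by apply: dvdz_mulr; apply: dvdz_mull; apply: dvdz_mulr.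
Qed.

Lemma dvdz_hform_subX d (c : nat -> int) y x :
  (y %| hform d c x y - c 0%N * x ^+ d)%Z.
Proof.
rewrite /hform big_ord_recl subn0 expr0 mulr1 addrC addKr.
apply: rpred_sum => k _; apply: dvdz_mull; rewrite exprS; exact: dvdz_mulr.
Qed.

Lemma primeN_coprimez p k (y : int) : prime p -> ~~ (p %| y)%Z -> coprimez (p ^ k)%N y.
Proof. by move=> pp py; rewrite coprimezE /= coprimeXl // prime_coprime. Qed.

Section RootClasses.

Variables (d : nat) (c : nat -> int) (M : nat) (u v : {poly int}).
Hypothesis c0 : c 0%N = 1.
Hypothesis bez : u * dehom d c + v * (dehom d c)^`() = (M%:Z)%:P.
Local Notation h := (hform d c).

(* Hensel uniqueness: a root modulo p of the separable polynomial [dehom d c] lifts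
   to at most one root modulo p^k. *)
Lemma hform_class_lift p k (x y x' y' : int) : prime p -> ~~ (p %| M)%N ->
  ~~ (p %| y)%Z -> ~~ (p %| y')%Z ->
  ((p ^ k)%N %| h x y)%Z -> ((p ^ k)%N %| h x' y')%Z ->
  (p %| x * y' - x' * y)%Z -> ((p ^ k)%N %| x * y' - x' * y)%Z.
Proof.
move=> pp pM py py'; case: k => [|k]; first by rewrite expn0 dvd1z.
set P : int := (p ^ k.+1)%N => Ph Ph' pxy.
have pP : (p %| P)%Z by rewrite /P expnS PoszM dvdz_mulr.
(* With j an inverse of t modulo P, the integer r = s j represents s / t and is a root of the
   dehomogenized form modulo P. *)
have root_of (s t : int) : ~~ (p %| t)%Z -> (P %| h s t)%Z ->
    exists r, (P %| s - r * t)%Z /\ (P %| (dehom d c).[r])%Z.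
  move=> pt Pst; have := primeN_coprimez k.+1 pp pt; rewrite -/P.
  case/coprimezP => -[i j] /= ij.
  have Pr : (P %| s - s * j * t)%Z.
    apply/dvdzP; exists (s * i); rewrite -[X in X - _]mulr1 -ij; ring.
  exists (s * j); split => //.
  have : (P %| t ^+ d * (dehom d c).[s * j])%Z.
    rewrite horner_dehom -hform_scale mulr1.
    have -> : h (t * (s * j)) t = h s t - (h s t - h (s * j * t) t).
      by rewrite opprB addrC subrK mulrC.
    by rewrite rpredB // dvdz_hform_sub.
  by rewrite mulrC Gauss_dvdzl // coprimezXr // primeN_coprimez.
have [r [Pr gr]] := root_of x y py Ph; have [r' [Pr' gr']] := root_of x' y' py' Ph'.
have Pd : (P %| x * y' - x' * y - (r - r') * (y * y'))%Z.
  have -> : x * y' - x' * y - (r - r') * (y * y') = (x - r * y) * y' - (x' - r' * y') * y by ring.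
  by rewrite rpredB // dvdz_mulr.
have prr : (p %| r - r')%Z.
  have : (p %| (r - r') * (y * y'))%Z.
    have -> : (r - r') * (y * y') =
        (x * y' - x' * y) - (x * y' - x' * y - (r - r') * (y * y')) by ring.
    by rewrite rpredB // (dvdz_trans pP).
  rewrite Gauss_dvdzl //; apply: (@primeN_coprimez p 1) => //.
  by rewrite dvdzE abszM Euclid_dvdM // -!dvdzE negb_or py.
(* Write g for [dehom d c]. Modulo p the cofactor of r - r' is g'(r'); were it divisible by p, then,
   p dividing g(r') too, [bez] would make p a divisor of M. Hence P divides r - r'. *)
have [w gE] := horner_taylor1 (dehom d c) r r'.
have Prr : (P %| r - r')%Z.
  have : (P %| (r - r') * ((dehom d c)^`().[r'] + (r - r') * w))%Z by rewrite -gE rpredB.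
  rewrite Gauss_dvdzl //; apply: primeN_coprimez => //.
  apply: contra pM => pd.
  have pg' : (p %| (dehom d c)^`().[r'])%Z.
    by rewrite -(addrK ((r - r') * w) _^`().[r']) rpredB // dvdz_mulr.
  have /(congr1 (horner^~ r')) := bez; rewrite hornerC hornerD !hornerM => ME.
  have : (p %| M%:Z)%Z by rewrite -ME rpredD // dvdz_mull // (dvdz_trans pP).
  by rewrite dvdzE.
by rewrite -(subrK ((r - r') * (y * y')) (x * y' - x' * y)) rpredD // dvdz_mulr.
Qed.

(** The point (x : y) in the affine chart. When p divides y the quotient is the default value 0, a
    case excluded wherever the class is used. *)
Definition root_class p (x y : int) : 'F_p := x%:~R / y%:~R.

Lemma Fp_intr_eq0 p (z : int) : prime p -> (z%:~R == 0 :> 'F_p) = (p %| z)%Z.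
Proof.
move=> pp; have pc := pchar_Fp pp.
rewrite dvdzE /= (dvdn_pcharf pc); case: z => n //=.
by rewrite NegzE rmorphN oppr_eq0.
Qed.

Lemma root_class_eq p (x y x' y' : int) : prime p ->
  ~~ (p %| y)%Z -> ~~ (p %| y')%Z -> root_class p x y = root_class p x' y' ->
  (p %| x * y' - x' * y)%Z.
Proof.
move=> pp py py' /eqP; rewrite /root_class eqr_div ?Fp_intr_eq0 //.
by rewrite -subr_eq0 -!intrM -intrB Fp_intr_eq0.
Qed.

Lemma root_class_root p (x y : int) : prime p -> ~~ (p %| y)%Z ->
  (p %| h x y)%Z -> root (map_poly intr (dehom d c)) (root_class p x y).
Proof.
move=> pp py; rewrite -!Fp_intr_eq0 // hform_rmorph /= in py *.
move=> /eqP h0; rewrite map_dehom /root horner_dehom /root_class.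
have yU : (y%:~R : 'F_p) ^+ d != 0 by rewrite expf_neq0.
rewrite -(inj_eq (mulfI yU)) -hform_scale mulr0 mulr1 mulrCA divff // mulr1.
exact/eqP.
Qed.

End RootClasses.

(** * Counting points where prime powers divide the value *)

Lemma card_congruent A P (S : {set 'I_A}) : (0 < P)%N ->
  {in S &, forall a b : 'I_A, a = b %[mod P]} -> (#|S| <= A %/ P + 1)%N.
Proof.
move=> P0 cong; rewrite addn1 -[X in (_ <= X)%N]card_ord.
(* Inside one class modulo P, a number is determined by its quotient by P. *)
pose f (a : 'I_A) : 'I_(A %/ P).+1 := inord (a %/ P).
rewrite -(card_in_imset (f := f) (D := S)); first exact: max_card.
move=> a b aS bS /(congr1 val); rewrite /f /= !inordK ?ltnS ?leq_div2r 1?ltnW //.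
move=> ab; apply/val_inj; rewrite /= (divn_eq a P) (divn_eq b P) ab.
by rewrite (cong a b).
Qed.

(** A geometric series with integer quotients; the last quotient is kept on the left to carry the
    induction. *)
Lemma sum_divn_exp p A E : (1 < p)%N ->
  ((\sum_(1 <= k < E.+1) A %/ p ^ k) * (p - 1) + A %/ p ^ E <= A)%N.
Proof.
move=> p1; elim: E => [|E IH]; first by rewrite big_geq // expn0 divn1.
rewrite big_nat_recr //=; apply: leq_trans IH.
rewrite mulnDl -addnA leq_add2l expnSr divnMA.
have := leq_trunc_div (A %/ p ^ E) p; move: (_ %/ p)%N => t.
by case: p p1 => // p _; rewrite subn1 /= mulnS addnC.
Qed.

(** The bound is a multiple of [z %/ p], to match the exponents in [prod_prime_fact]. *)
Lemma sum_divn_exp_le p z A' E : (1 < p)%N -> (p <= z)%N ->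
  (\sum_(1 <= k < E.+1) (A' * z) %/ p ^ k <= 4 * A' * (z %/ p))%N.
Proof.
move=> p1 pz; have p0 : (0 < p)%N by exact: ltnW.
have := @sum_divn_exp p (A' * z) E p1; set S := (\sum_(_ <= _ < _) _)%N => hS.
have {}hS : (S * (p - 1) <= A' * z)%N by apply: leq_trans hS; rewrite leq_addr.
(* With integer quotients, z < p (z / p + 1) <= 2 p (z / p) <= 4 (p - 1) (z / p). *)
have zp : (z <= 4 * (p - 1) * (z %/ p))%N.
  have q1 : (1 <= z %/ p)%N by rewrite divn_gt0.
  have := ltn_ceil z p0; nia.
rewrite -(@leq_pmul2r (p - 1)) ?subn_gt0 //; apply: leq_trans hS _.
have -> : (4 * A' * (z %/ p) * (p - 1) = A' * (4 * (p - 1) * (z %/ p)))%N by ring.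
by rewrite leq_mul2l zp orbT.
Qed.

Lemma logn_le_sum p E n : prime p -> (0 < n)%N -> (logn p n <= E)%N ->
  (logn p n <= \sum_(1 <= k < E.+1) (p ^ k %| n))%N.
Proof.
move=> pp n0 lE; under eq_bigr => k _ do rewrite pfactor_dvdn //.
rewrite (@big_cat_nat _ _ _ (logn p n).+1) //=.
rewrite big_nat_cond (eq_bigr (fun=> 1%N)); last first.
  by move=> k /andP[/andP[_ kl] _]; rewrite -ltnS kl.
by rewrite -big_nat_cond sum_nat_const_nat muln1 subn1 leq_addr.
Qed.

Section Counting.

Variables (d : nat) (c : nat -> int) (M : nat) (u v : {poly int}).
Hypothesis c0 : c 0%N = 1.
Hypothesis bez : u * dehom d c + v * (dehom d c)^`() = (M%:Z)%:P.
Local Notation h := (hform d c).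

(** The points fall into at most d root classes modulo p. Inside a class, [hform_class_lift] and the
    coprimality of p with M y force the [a] to be congruent modulo p^(k+1). *)
Lemma card_dvd_hform p k A (x0 y : int) : prime p -> ~~ (p %| M)%N ->
  ~~ (p %| y)%Z ->
  (#|[set a : 'I_A | (p ^ k.+1)%N %| `|h (x0 + (M * a)%N%:Z) y|]|
     <= d * (A %/ p ^ k.+1 + 1))%N.
Proof.
move=> pp pM py; set S := [set a | _].
have Sp a : a \in S -> ((p ^ k.+1)%N %| h (x0 + (M * a)%N%:Z) y)%Z by rewrite inE dvdzE.
pose f (a : 'I_A) := root_class p (x0 + (M * a)%N%:Z) y.
have g0 : map_poly (intr : int -> 'F_p) (dehom d c) != 0.
  by rewrite map_dehom monic_neq0 // dehom_monic //= c0.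
have imf : (size (undup [seq f a | a in S]) <= d)%N.
  have := @size_image_roots _ _ _ f S g0; rewrite map_dehom size_dehom /= ?c0 //.
  apply=> a /Sp ha; rewrite -map_dehom; apply: root_class_root => //.
  by apply: dvdz_trans ha; rewrite expnS PoszM dvdz_mulr.
apply: leq_trans (card_le_fibres (f := f) (m := A %/ p ^ k.+1 + 1) _) _; last first.
  by rewrite leq_mul2r imf orbT.
move=> w; apply: card_congruent => [|a b]; first by rewrite expn_gt0 prime_gt0.
rewrite !inE -/(f _) => /andP[Sa /eqP fa] /andP[Sb /eqP fb].
have := hform_class_lift bez pp pM py py (Sp a _) (Sp b _) (root_class_eq pp py py _).
rewrite !inE Sa Sb => /(_ isT isT (etrans fa (esym fb))).
have -> : (x0 + (M * a)%N%:Z) * y - (x0 + (M * b)%N%:Z) * y = (a%:Z - b%:Z) * (M%:Z * y).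
  by rewrite !PoszM; ring.
rewrite Gauss_dvdzl; last first.
  by apply: primeN_coprimez => //; rewrite dvdzE abszM Euclid_dvdM // -dvdzE negb_or pM py.
by rewrite -eqz_mod_dvd !modz_nat eqz_nat => /eqP.
Qed.

(** The exponent of p is the number of k >= 1 with p^k dividing the value, and such k are at most
    [trunc_log p C]. The second summand collects the terms + 1 of [card_dvd_hform]. *)
Lemma sum_logn_hform p A (x0 y : int) C : prime p -> ~~ (p %| M)%N ->
  ~~ (p %| y)%Z ->
  (forall a : 'I_A, (0 < `|h (x0 + (M * a)%N%:Z) y| <= C)%N) ->
  (\sum_(a < A) logn p `|h (x0 + (M * a)%N%:Z) y| <=
    d * (\sum_(1 <= k < (trunc_log p C).+1) A %/ p ^ k + trunc_log p C))%N.
Proof.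
move=> pp pM py hC; set E := trunc_log p C.
apply: (@leq_trans (\sum_(a < A) \sum_(1 <= k < E.+1) (p ^ k %| `|h (x0 + (M * a)%N%:Z) y|))%N).
  apply: leq_sum => a _; have /andP[h0 hle] := hC a.
  apply: logn_le_sum => //; apply: trunc_log_max; first exact: prime_gt1.
  by apply: leq_trans hle; apply: dvdn_leq => //; exact: pfactor_dvdnn.
rewrite exchange_big /=.
apply: (@leq_trans (\sum_(1 <= k < E.+1) d * (A %/ p ^ k + 1))%N).
  rewrite !big_add1 /=; apply: leq_sum => k _.
  have := card_dvd_hform k A x0 pp pM py; rewrite -sum1dep_card big_mkcond /=.
  by apply: leq_trans; apply: leq_sum => a _; case: (_ %| _)%N.
rewrite -big_distrr /= leq_mul2l big_split /= sum_nat_const_nat muln1 subn1 leqnn.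
by rewrite orbT.
Qed.

End Counting.

(** * Smooth parts of the values *)

Definition upto (z : nat) : nat_pred := [pred p : nat | (p <= z)%N].

Lemma smooth_part z n : (0 < n)%N ->
  (n`_(upto z) = \prod_(1 <= p < z.+1 | prime p) p ^ logn p n)%N.
Proof.
move=> n0; pose N := maxn n z.
rewrite (@widen_partn N) ?leq_maxl // big_mkcond /=.
rewrite [LHS]big_ltn // lognE /= expn0 mul1n (@big_cat_nat _ _ _ z.+1) //=;
  last by rewrite ltnS leq_maxr.
rewrite [X in (_ * X)%N]big_nat_cond [X in (_ * X)%N]big1 ?muln1; last first.
  by move=> p /andP[/andP[zp _] _]; rewrite inE leqNgt zp.
rewrite [RHS]big_mkcond; apply: eq_big_nat => p /andP[_ pz].
rewrite inE -ltnS pz; case: ifP => // np.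
by rewrite lognE np.
Qed.

(* This crude bound takes the place of Mertens' estimate of the sum of log p / p. *)
Lemma prod_prime_fact z : (\prod_(1 <= p < z.+1 | prime p) p ^ (z %/ p) <= z`!)%N.
Proof.
apply: (@leq_trans (z`!`_(upto z))); last first.
  by apply: dvdn_leq; rewrite ?fact_gt0 ?dvdn_part.
rewrite smooth_part ?fact_gt0 // big_nat_cond [leqRHS]big_nat_cond.
(* The exponent z / p is the first term of Legendre's formula for z!. *)
apply: leq_prod => p /andP[/andP[p0 pz] pp]; rewrite leq_pexp2l // logn_fact //.
by rewrite (big_ltn (leq_ltn_trans p0 pz)) expn1 leq_addr.
Qed.

Lemma fact_le_exp z : (z`! <= z ^ z)%N.
Proof.
elim: z => // z IH; rewrite factS expnS leq_mul2l /=.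
by apply: leq_trans IH _; case: z => // z; rewrite leq_exp2r.
Qed.

Section SmoothPart.

Variables (d : nat) (c : nat -> int) (M : nat) (u v : {poly int}).
Hypothesis c0 : c 0%N = 1.
Hypothesis bez : u * dehom d c + v * (dehom d c)^`() = (M%:Z)%:P.
Local Notation h := (hform d c).

Variables (A B : nat).

(** The residue 1 modulo [M] makes x prime to [M]. The shift by [A] keeps x between M A and about 2
    M A, so that it can dominate y. *)
Definition xcoord (a : nat) : nat := (1 + M * (A + a))%N.

Definition value (a i : nat) : nat := `|h (xcoord a)%:Z (M * i.+1)%N%:Z|%N.

Definition coprime_points : {set 'I_A * 'I_B} :=
  [set t : 'I_A * 'I_B | coprime (xcoord t.1) t.2.+1].

(** As the form is monic, its value is x^d modulo y. A prime dividing the value and y therefore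
    divides x, but x is prime to both [M] and i + 1. *)
Lemma prime_dvd_value a i p : coprime (xcoord a) i.+1 -> prime p ->
  (p %| value a i)%N -> ~~ (p %| M * i.+1)%N.
Proof.
move=> co pp pn; apply/negP => pY.
have pX : (p %| xcoord a)%N.
  have : (p %| (xcoord a)%:Z ^+ d)%Z.
    have := dvdz_hform_subX d c (M * i.+1)%N (xcoord a); rewrite c0 mul1r => hX.
    rewrite -(subKr (h (xcoord a)%:Z (M * i.+1)%N%:Z) (_ ^+ d)) rpredB //.
    by apply: dvdz_trans hX; rewrite dvdzE.
  by rewrite dvdzE /= abszX Euclid_dvdX // => /andP[].
have : (p %| gcdn (xcoord a) i.+1)%N.
  rewrite dvdn_gcd pX; move: pY; rewrite Euclid_dvdM // => /orP[pM|//].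
  by move: pX; rewrite /xcoord dvdn_addl ?dvdn1 ?dvdn_mulr // => /eqP p1; rewrite p1 in pp.
by rewrite (eqP co) dvdn1 => /eqP p1; rewrite p1 in pp.
Qed.

Variables (C : nat).
Hypothesis hC : forall a i, (a < A)%N -> (i < B)%N -> (0 < value a i <= C)%N.

Lemma sum_logn_value p : prime p ->
  (\sum_(t in coprime_points) logn p (value t.1 t.2) <=
   B * (d * (\sum_(1 <= k < (trunc_log p C).+1) A %/ p ^ k + trunc_log p C)))%N.
Proof.
move=> pp; set K := (d * _)%N.
rewrite -[X in (_ <= X * _)%N]card_ord -sum_nat_const.
apply: (@leq_trans (\sum_(i < B) \sum_(a < A | coprime (xcoord a) i.+1) logn p (value a i)))%N.
  rewrite (exchange_big_dep xpredT) //= pair_big_dep /=.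
  by rewrite [leqLHS](eq_bigl (fun t : 'I_A * 'I_B => coprime (xcoord t.1) t.2.+1)) // => t;
    rewrite inE.
(* For fixed y, either p divides y and no value is divisible by p, or the count along x applies. *)
apply: leq_sum => i _; case: (boolP (p %| M * i.+1)%N) => [pY|pY].
  rewrite big1 // => a co; apply/eqP; rewrite -leqn0 leqNgt logn_gt0 mem_primes pp.
  by apply: contraL pY => /and3P[_ _]; exact: prime_dvd_value co pp.
apply: (@leq_trans (\sum_(a < A) logn p (value a i))%N).
  by rewrite [leqRHS](bigID (fun a : 'I_A => coprime (xcoord a) i.+1)) leq_addr.
have xE a : (xcoord a)%:Z = (1 + M * A)%N%:Z + (M * a)%N%:Z.
  by rewrite -PoszD /xcoord mulnDr addnA.
have pM : ~~ (p %| M)%N by apply: contra pY => ?; rewrite dvdn_mulr.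
have := @sum_logn_hform d c M u v c0 bez p A (1 + M * A)%N%:Z (M * i.+1)%N%:Z C pp pM.
rewrite dvdzE => /(_ pY) sl.
rewrite /value; under eq_bigr => a _ do rewrite xE.
by apply: sl => a; rewrite -xE; apply: hC.
Qed.

(** The main terms multiply to a power of the product of the p^(z/p), which is at most z! <= z^z;
    this gives the first factor since A = A' z. The error terms cost at most C^(d B) for each of the
    at most z primes. *)
Lemma prod_smooth_part z A' : A = (A' * z)%N -> (0 < C)%N ->
  (\prod_(t in coprime_points) (value t.1 t.2)`_(upto z) <=
    z ^ (4 * d * A * B) * C ^ (d * B * z))%N.
Proof.
move=> AE C0.
under eq_bigr => t _.
  rewrite smooth_part; last by have /andP[] := hC (ltn_ord t.1) (ltn_ord t.2).
  over.
rewrite exchange_big /=; under eq_bigr => p _ do rewrite -expn_sum.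
pose E p := trunc_log p C.
apply: (@leq_trans (\prod_(1 <= p < z.+1 | prime p)
    ((p ^ (z %/ p)) ^ (4 * d * A' * B) * C ^ (d * B)))%N).
  rewrite big_nat_cond [leqRHS]big_nat_cond.
  apply: leq_prod => p /andP[/andP[_ pz] pp]; rewrite ltnS in pz.
  have p1 := prime_gt1 pp.
  apply: (@leq_trans (p ^ ((z %/ p) * (4 * d * A' * B) + E p * (d * B))))%N.
    rewrite leq_exp2l //; apply: leq_trans (sum_logn_value pp) _.
    have := sum_divn_exp_le A' (E p) p1 pz; rewrite -AE -/(E p).
    set S := (\sum_(_ <= _ < _) _)%N => hS.
    apply: (@leq_trans (B * (d * (4 * A' * (z %/ p) + E p))))%N.
      by rewrite !leq_mul // leq_add2r.
    by rewrite [leqRHS](_ : _ = (B * (d * (4 * A' * (z %/ p) + E p))))%N //; ring.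
  rewrite expnD (expnM _ (z %/ p)) (expnM _ (E p)) leq_mul //.
  have [->|dB] := posnP (d * B)%N; first by rewrite !expn0.
  by rewrite leq_exp2r // trunc_logP.
rewrite big_split /=; apply: leq_mul.
  rewrite -(big_morph _ (fun x y => expnMn x y (4 * d * A' * B)) (exp1n _)).
  apply: (@leq_trans ((z ^ z) ^ (4 * d * A' * B))%N).
    have [->|K0] := posnP (4 * d * A' * B)%N; first by rewrite !expn0.
    by rewrite leq_exp2r // (leq_trans (prod_prime_fact z)) // fact_le_exp.
  by rewrite -expnM AE (_ : z * _ = 4 * d * (A' * z) * B)%N //; ring.
rewrite big_mkcond /= (expnM _ (d * B)).
have -> : ((C ^ (d * B)) ^ z = \prod_(1 <= p < z.+1) C ^ (d * B))%N.
  by rewrite prod_nat_const_nat subn1.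
by apply: leq_prod => p _; case: ifP => // _; rewrite expn_gt0 C0.
Qed.

End SmoothPart.

(** * Counting the values *)

Lemma card_multiples B e : (0 < e)%N -> #|[set i : 'I_B | e %| i.+1]%N| = (B %/ e)%N.
Proof.
move=> e0; rewrite divn_count_dvd big_add1 /= big_mkord -sum1dep_card big_mkcond /=.
by apply: eq_bigr => i _; case: (_ %| _)%N.
Qed.

Lemma card_xcoord_multiples A M e : (0 < e)%N -> coprime e M ->
  (#|[set a : 'I_A | e %| xcoord M A a]%N| <= A %/ e + 1)%N.
Proof.
move=> e0 eM; apply: card_congruent => // a b; rewrite !inE => ea eb.
have : (e %| M%:Z * (a%:Z - b%:Z))%Z.
  have -> : M%:Z * (a%:Z - b%:Z) = (xcoord M A a)%:Z - (xcoord M A b)%:Z.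
    by rewrite /xcoord !PoszD !PoszM !PoszD; ring.
  by rewrite rpredB // dvdzE.
rewrite Gauss_dvdzr //.
by rewrite -eqz_mod_dvd !modz_nat eqz_nat => /eqP.
Qed.

(** The count is at most (A / e + 1) (B / e) <= 2 A B / e^2 <= 2 A B / (e (e - 1)), written in
    telescoping form. *)
Lemma card_noncoprime_divisor A B M e : (5 <= e)%N -> (e <= A)%N ->
  (#|[set t : 'I_A * 'I_B | [&& e %| xcoord M A t.1, e %| t.2.+1 & coprime e M]]%N|%:R
   <= (2 * A * B)%:R * (e.-1%:R^-1 - e%:R^-1) :> rat).
Proof.
move=> e5 eA; have e0 : (0 < e)%N by lia.
have rhs : (2 * A * B)%:R * (e.-1%:R^-1 - e%:R^-1) = (2 * A * B)%:R / (e.-1 * e)%:R :> rat.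
  have eQ : e%:R != 0 :> rat by rewrite pnatr_eq0 -lt0n.
  have e1Q : e.-1%:R != 0 :> rat by rewrite pnatr_eq0 -lt0n; lia.
  have eE : e%:R = e.-1%:R + 1 :> rat by rewrite natr1 prednK.
  have key (a b : rat) : a != 0 -> b != 0 -> b = a + 1 -> a^-1 - b^-1 = (a * b)^-1.
    by move=> a0 b0 ba; rewrite ba in b0 *; field; rewrite a0 b0.
  by rewrite key // -natrM.
rewrite rhs ler_pdivlMr ?ltr0n ?muln_gt0 ?e0 ?andbT -?natrM ?ler_nat; last by lia.
case: (boolP (coprime e M)) => [eM|eM]; last first.
  rewrite (_ : [set _ | _] = finset.set0) ?cards0 //.
  by apply/setP => t; rewrite !inE !andbF.
apply: (@leq_trans ((A %/ e + 1) * (B %/ e) * (e.-1 * e))%N).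
  rewrite leq_mul2r; apply/orP; right.
  have <- := card_multiples B e0.
  apply: leq_trans (leq_mul (card_xcoord_multiples A e0 eM) (leqnn _)).
  rewrite -cardsX; apply: subset_leq_card; apply/fintype.subsetP => t; rewrite !inE.
  by move=> /and3P[-> ->].
have hA := leq_trunc_div A e; have hB := leq_trunc_div B e.
have : (1 <= A %/ e)%N by rewrite divn_gt0.
move: (A %/ e)%N (B %/ e)%N hA hB => q r hA hB q1.
apply: (@leq_trans ((2 * q) * r * (e * e)))%N.
  by rewrite !leq_mul //; lia.
by apply: (@leq_trans (2 * ((q * e) * (r * e))))%N; [nia | rewrite -(mulnA 2 A B) leq_mul2l leq_mul].
Qed.

(** The gcd e of a pair that is not coprime divides x, hence is prime to M and so to 6, which forces
    e >= 5. The telescoping bounds over e >= 5 add up to at most 2 A B / 4, half of all pairs. *)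
Lemma card_coprime_points A B M : (6 %| M)%N -> (B <= A)%N ->
  (A * B <= 2 * #|coprime_points M A B|)%N.
Proof.
move=> M6 BA.
pose N e := [set t : 'I_A * 'I_B | [&& e %| xcoord M A t.1, e %| t.2.+1 & coprime e M]]%N.
have sub : (#|~: coprime_points M A B| <= \sum_(5 <= e < B.+1) #|N e|)%N.
  have chi e t : (t \in N e) = [&& e %| xcoord M A t.1, e %| t.2.+1 & coprime e M]%N.
    by rewrite inE.
  under eq_bigr => e _ do rewrite -sum1_card big_mkcond.
  rewrite exchange_big -sum1_card big_mkcond; apply: leq_sum => t _ /=.
  rewrite !inE; case: ifP => // nco.
  set e := gcdn (xcoord M A t.1) t.2.+1 in nco *.
  have e0 : (0 < e)%N by rewrite gcdn_gt0 orbT.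
  have eB : (e <= B)%N.
    by rewrite (leq_trans _ (ltn_ord t.2)) // dvdn_leq // dvdn_gcdr.
  have eM : coprime e M.
    apply: coprime_dvdl (dvdn_gcdl _ _) _.
    by rewrite /xcoord mulnC /coprime gcdnC addnC gcdnMDl gcdn1.
  have e5 : (5 <= e)%N.
    have e6 : coprime e 6 := coprime_dvdr M6 eM.
    have : (e != 1)%N by rewrite /e -/(coprime _ _) nco.
    by move: e0 e6; move: (e) => [|[|[|[|[|]]]]].
  rewrite (bigD1_seq e) ?iota_uniq //=; last by rewrite mem_index_iota e5 ltnS.
  by rewrite chi dvdn_gcdl dvdn_gcdr eM leq_addr.
have : ((#|~: coprime_points M A B| * 2)%:R <= (A * B)%:R :> rat).
  rewrite muln2 -addnn natrD.
  have h1 : #|~: coprime_points M A B|%:R <= (2 * A * B)%:R * (4%:R^-1) :> rat.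
    apply: (@le_trans _ _ (\sum_(5 <= e < B.+1) #|N e|)%:R); first by rewrite ler_nat.
    have [B5|B5] := leqP B.+1 5; first by rewrite big_geq // mulr_ge0 ?ler0n ?invr_ge0 ?ler0n.
    apply: (@le_trans _ _ ((2 * A * B)%:R * (4%:R^-1 - B%:R^-1))); last first.
      by rewrite ler_wpM2l ?ler0n // gerBl invr_ge0 ler0n.
    have -> : 4%:R^-1 - B%:R^-1 = \sum_(5 <= e < B.+1) (e.-1%:R^-1 - e%:R^-1) :> rat.
      have := @telescope_sumr _ 5 B.+1 (fun e => - e.-1%:R^-1 : rat) (ltnW B5).
      under eq_bigr => e _ do rewrite /= opprK addrC.
      by move=> ->; rewrite opprK addrC.
    rewrite natr_sum mulr_sumr big_nat [leRHS]big_nat; apply: ler_sum => e /andP[e5 eB].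
    by apply: card_noncoprime_divisor e5 _; rewrite (leq_trans _ BA).
  apply: (le_trans (lerD h1 h1)).
  by rewrite !natrM le_eqVlt; apply/orP; left; apply/eqP; field.
rewrite ler_nat => hN; have := cardsC (coprime_points M A B).
by rewrite card_prod !card_ord; lia.
Qed.

Lemma hform_close d (c : nat -> int) (x y : nat) : c 0%N = 1 -> (y <= x)%N ->
  `|hform d.+1 c x y - x%:Z ^+ d.+1| <=
    (\sum_(k < d.+2) `|c k|)%N%:Z * (x%:Z ^+ d * y%:Z).
Proof.
move=> c0 yx; rewrite /hform [X in `|X - _|]big_ord_recl c0 subn0 expr0 mulr1 mul1r addrC addKr.
rewrite [X in _ <= Posz X * _]big_ord_recl PoszD mulrDl -[leLHS]add0r lerD ?mulr_ge0 ?exprn_ge0 //.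
apply: le_trans (ler_norm_sum _ _ _) _; rewrite (big_morph Posz PoszD (erefl _)) mulr_suml.
apply: ler_sum => k _; rewrite !normrM !normrX !abszE.
rewrite -mulrA ler_wpM2l // ?normr_ge0 //= /bump /= add1n subSS.
have -> : x%:Z ^+ d = x%:Z ^+ (d - k) * x%:Z ^+ k by rewrite -exprD subnK // -ltnS.
rewrite -mulrA ler_wpM2l ?exprn_ge0 // exprS mulrC ler_wpM2r //.
by rewrite lerXn2r.
Qed.

(** The terms other than x^(d+1) add up to at most H x^d Y <= x^(d+1) - x^d Y in absolute value. *)
Lemma hform_bounds d (c : nat -> int) (x y Y : nat) :
  let H := (\sum_(k < d.+2) `|c k|)%N in
  c 0%N = 1 -> (y <= Y)%N -> ((H + 1) * Y <= x)%N ->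
  0 <= hform d.+1 c x y /\ (x ^ d * Y <= `|hform d.+1 c x y| <= 2 * x ^ d.+1)%N.
Proof.
move=> H c0 yY hx.
have yx : (y <= x)%N by apply: leq_trans yY (leq_trans _ hx); rewrite leq_pmull // addn1.
have := hform_close d c0 yx; rewrite -/H => close.
have Hx : H%:Z * (x%:Z ^+ d * Y%:Z) + x%:Z ^+ d * Y%:Z <= x%:Z ^+ d.+1.
  have -> : H%:Z * (x%:Z ^+ d * Y%:Z) + x%:Z ^+ d * Y%:Z = x%:Z ^+ d * ((H + 1) * Y)%N%:Z.
    by rewrite PoszM PoszD; ring.
  by rewrite exprSr ler_wpM2l ?exprn_ge0 // lez_nat.
have xy0 : 0 <= x%:Z ^+ d * Y%:Z by rewrite mulr_ge0 ?exprn_ge0.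
have hyY : H%:Z * (x%:Z ^+ d * y%:Z) <= H%:Z * (x%:Z ^+ d * Y%:Z).
  by rewrite !ler_wpM2l ?exprn_ge0.
move: close; rewrite ler_norml => /andP[lo hi].
have h0 : 0 <= hform d.+1 c x y by lra.
split => //.
have PX k : (x ^ k)%N%:Z = x%:Z ^+ k by rewrite -!natz natrX.
rewrite -!lez_nat gez0_abs // !PoszM !PX.
by apply/andP; split; lra.
Qed.

(** In the factorization of w, each prime greater than z contributes a factor of at least z. *)
Lemma exp_size_primes_le z w : (0 < w)%N ->
  (z ^ size [seq p <- primes w | z < p] <= w)%N.
Proof.
move=> w0; rewrite [leqRHS](prod_prime_decomp w0) prime_decompE big_map /=.
rewrite -iter_muln_1 -count_predT -big_const_seq big_filter big_mkcond big_seq [leqRHS]big_seq.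
apply: leq_prod => p pw; move: (pw); rewrite mem_primes => /and3P[pp _ _].
case: ifP => [zp|_]; last by rewrite pfactor_gt0.
apply: leq_trans (ltnW zp) _; rewrite -[X in (X <= _)%N]expn1.
by rewrite (leq_pexp2l (prime_gt0 pp)) // logn_gt0.
Qed.

Lemma proportional_coprime x y x' y' : coprime x y -> coprime x' y' ->
  (x * y' = x' * y)%N -> (0 < y)%N -> (0 < y')%N -> x = x' /\ y = y'.
Proof.
move=> co co' e y0 y'0.
have xx' : x = x'.
  apply/eqP; rewrite eqn_dvd -(Gauss_dvdl x' co) -e dvdn_mulr //=.
  by rewrite -(Gauss_dvdl x co') e dvdn_mulr.
split=> //; move: e; rewrite -xx'; case: (posnP x) => [x0 _|x0 /eqP].
  by move: co co'; rewrite -xx' x0 /coprime !gcd0n => /eqP-> /eqP->.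
by rewrite eqn_pmul2l // => /eqP.
Qed.

Section ManyValues.

Variables (n : nat) (c : nat -> int) (M : nat) (u v : {poly int}).
Local Notation d := n.+3.
Hypothesis c0 : c 0%N = 1.
Hypothesis bez : u * dehom d c + v * (dehom d c)^`() = (M%:Z)%:P.
Hypothesis M0 : (0 < M)%N.
Hypothesis M6 : (6 %| M)%N.

(** [L] makes x > M A = M L B large enough for [hform_bounds]. [W] comes from values <= 2 x^d with x
    <= 2 M L B. [K] gives B = z^(20 d) z, so a smooth part below z^(20 d) is below B / z. *)
Let H := (\sum_(k < d.+1) `|c k|)%N.
Let L := (H + 1)%N.
Let W := (2 * (2 * M * L) ^ d)%N.
Let K := (20 * d).+1.

Variable z : nat.
Hypothesis zW : (W <= z)%N.
Hypothesis zK : (K * d + 1 <= z)%N.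

Let B := (z ^ K)%N.
Let A := (L * B)%N.
Let C := (W * B ^ d)%N.
Local Notation x := (xcoord M A).
Local Notation val := (value d c M A).
Local Notation T := (coprime_points M A B).

Let L0 : (0 < L)%N. Proof. by rewrite /L addn1. Qed.
Let z1 : (1 < z)%N. Proof. by apply: leq_trans zK; rewrite addn1 ltnS. Qed.
Let z0 : (0 < z)%N. Proof. exact: ltnW. Qed.
Let B0 : (0 < B)%N. Proof. by rewrite expn_gt0 z0. Qed.
Let W0 : (0 < W)%N. Proof. by rewrite muln_gt0 expn_gt0 !muln_gt0 M0 L0. Qed.
Let C0 : (0 < C)%N. Proof. by rewrite muln_gt0 W0 expn_gt0 B0. Qed.

Lemma x_le a : (a < A)%N -> (x a <= 2 * M * A)%N.
Proof. by rewrite /xcoord => aA; nia. Qed.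

Lemma MA_lt_x a : (M * A < x a)%N.
Proof. by rewrite /xcoord mulnDr; lia. Qed.

Lemma value_bounds a i : (a < A)%N -> (i < B)%N ->
  0 <= hform d c (x a) (M * i.+1)%N /\ (B ^ d <= val a i <= C)%N.
Proof.
move=> aA iB; have MA := MA_lt_x a.
have [||h0 /andP[lo hi]] := @hform_bounds n.+2 c (x a) (M * i.+1) (M * B) c0.
- by rewrite leq_mul2l iB orbT.
- by apply: leq_trans (ltnW MA); rewrite mulnCA.
split => //; apply/andP; split.
  apply: leq_trans lo; rewrite expnSr leq_mul ?leq_pmull //.
  rewrite leq_exp2r // (leq_trans _ (ltnW MA)) // /A mulnA leq_pmull //.
  by rewrite muln_gt0 M0.
apply: leq_trans hi _; rewrite /C /W -mulnA leq_mul2l -expnMn leq_exp2r //=.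
by apply: leq_trans (x_le aA) _; rewrite /A !mulnA.
Qed.

Lemma C_le : (C <= z ^ (K * d + 1))%N.
Proof. by rewrite /C /B -expnM addn1 expnS leq_mul. Qed.

Definition good_points : {set 'I_A * 'I_B} :=
  [set t in T | ((val t.1 t.2)`_(upto z) < z ^ (20 * d))%N].

(** A bad point has smooth part at least z^(20 d), while all smooth parts multiply to at most z^(5 d
    A B). So at most A B / 4 of the at least A B / 2 coprime points are bad. *)
Lemma card_good_points : (A * B <= 4 * #|good_points|)%N.
Proof.
have T2 : (A * B <= 2 * #|T|)%N.
  by apply: card_coprime_points => //; rewrite /A leq_pmull.
pose bad := [set t in T | (z ^ (20 * d) <= (val t.1 t.2)`_(upto z))%N].
have badT : (#|T| <= #|good_points| + #|bad|)%N.
  apply: leq_trans (leq_card_setU _ _); apply: subset_leq_card.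
  by apply/fintype.subsetP => t; rewrite !inE => ->; case: ltnP.
suff : (4 * #|bad| <= A * B)%N by lia.
have valC a i : (a < A)%N -> (i < B)%N -> (0 < val a i <= C)%N.
  move=> aA iB; have [_ /andP[lo ->]] := value_bounds aA iB.
  by rewrite (leq_trans _ lo) // expn_gt0 B0.
have AE : A = (L * z ^ (20 * d) * z)%N by rewrite /A /B /K expnSr mulnA.
have := prod_smooth_part c0 bez valC AE C0 => prodT.
have : ((z ^ (20 * d)) ^ #|bad| <= z ^ (5 * d * A * B))%N.
  rewrite -prod_nat_const.
  apply: (@leq_trans (\prod_(t in T) (val t.1 t.2)`_(upto z))%N).
    rewrite [leqRHS](bigID (mem bad)) /= -[leqLHS]muln1.
    apply: leq_mul; last by rewrite prodn_gt0 // => t; exact: part_gt0.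
    rewrite [leqRHS](eq_bigl (mem bad)); last first.
      by move=> t; rewrite !inE; case: (coprime _ _).
    by apply: leq_prod => t; rewrite inE => /andP[].
  apply: leq_trans prodT _.
  have -> : (5 * d * A * B = 4 * d * A * B + d * A * B)%N by ring.
  rewrite expnD leq_mul2l; apply/orP; right.
  (* The factor C^(d B z) is at most z^(d A B), because C <= z^(K d + 1), K d + 1 <= z and z^2 <=
     A. *)
  apply: (@leq_trans ((z ^ (K * d + 1)) ^ (d * B * z))%N).
    have dBz : (0 < d * B * z)%N by rewrite muln_gt0 z0 andbT muln_gt0 B0.
    by rewrite leq_exp2r ?C_le.
  rewrite -expnM leq_exp2l //.
  apply: (@leq_trans (z * (d * B * z)))%N; first by rewrite leq_mul2r zK orbT.
  apply: (@leq_trans (d * B * (z * z))%N); first by rewrite mulnCA.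
  have zzA : (z * z <= A)%N.
    rewrite AE leq_mul2r -[X in (X <= _)%N]expn1; apply/orP; right.
    by rewrite (leq_trans (leq_pexp2l z0 (_ : 1 <= 20 * d)%N)) // leq_pmull.
  by apply: (@leq_trans (d * B * A)%N); [rewrite leq_mul2l zzA orbT | lia].
rewrite -expnM leq_exp2l // => hb.
have : (5 * d * (4 * #|bad|) <= 5 * d * (A * B))%N by lia.
by rewrite leq_pmul2l.
Qed.

(* Points of a fibre are separated by the root classes modulo the primes p > z dividing w. *)
Lemma card_good_fibre w :
  (#|[set t in good_points | val t.1 t.2 == w]| <= d ^ (K * d + 1))%N.
Proof.
set S := [set t in _ | _].
have [->|[t0 t0S]] := set_0Vmem S; first by rewrite cards0.
have SP t : t \in S -> [/\ coprime (x t.1) t.2.+1,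
    (w`_(upto z) < z ^ (20 * d))%N & val t.1 t.2 = w].
  by rewrite !inE => /andP[/andP[co sm] /eqP <-].
have /andP[wlo whi] : (B ^ d <= w <= C)%N.
  by have [_ _ <-] := SP _ t0S; have [_] := value_bounds (ltn_ord t0.1) (ltn_ord t0.2).
have w0 : (0 < w)%N by apply: leq_trans wlo; rewrite expn_gt0 B0.
pose l := [seq p <- primes w | z < p]%N.
pose f p (t : 'I_A * 'I_B) : 'F_p := root_class p (x t.1)%:Z (M * t.2.+1)%N%:Z.
have lP p t : t \in S -> p \in primes w ->
    [/\ prime p, ~~ (p %| M)%N & ~~ (p %| (M * t.2.+1)%N%:Z)%Z].
  move=> /SP[co _ vw]; rewrite mem_primes => /and3P[pp _ pw].
  rewrite -vw in pw; have pMy := prime_dvd_value c0 co pp pw.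
  by split => //; apply: contra pMy => ?; rewrite dvdn_mulr.
(* At most K d + 1 primes greater than z divide w, since z^(size l) <= w <= C <= z^(K d + 1). *)
apply: (@leq_trans (d ^ size l)%N); last first.
  rewrite leq_exp2l // -(leq_exp2l _ _ z1).
  apply: leq_trans (exp_size_primes_le z w0) (leq_trans whi C_le).
apply: (@card_le_prod_fibres _ (fun p => 'F_p) f) => [p|s t sS tS st].
  rewrite mem_filter => /andP[_ pl].
  have g0 : map_poly (intr : int -> 'F_p) (dehom d c) != 0.
    by rewrite map_dehom monic_neq0 // dehom_monic //= c0.
  have := @size_image_roots _ _ _ (f p) S g0; rewrite map_dehom size_dehom /= ?c0 //.
  apply=> t tS; have [pp pM py] := lP p t tS pl; rewrite -map_dehom.
  apply: root_class_root => //; have [_ _ vw] := SP t tS.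
  by move: pl; rewrite mem_primes dvdzE -vw => /and3P[].
have [cos sm vs] := SP s sS; have [cot _ vt] := SP t tS.
pose q := (w`_((upto z)^'))%N.
have q0 : (0 < q)%N by exact: part_gt0.
have wE : (w`_(upto z) * q)%N = w by exact: partnC.
(* Otherwise q <= 2 M L B^2 <= z B^2, and the smooth part being less than B / z, w would be less
   than B^3 <= B^d. This is where the degree has to be at least 3. *)
have qbig : (2 * M * A * B < q)%N.
  rewrite ltnNge; apply/negP => qle.
  have : (w < B ^ d)%N; last by rewrite ltnNge wlo.
  apply: (@leq_trans (B ^ 3)%N); last by rewrite leq_pexp2l.
  rewrite -wE; apply: (@leq_trans (z ^ (20 * d) * q)%N); first by rewrite ltn_pmul2r.
  apply: (@leq_trans (z ^ (20 * d) * (z * (B * B)))%N).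
    rewrite leq_mul2l (leq_trans qle) ?orbT // /A mulnA -(mulnA _ B B) leq_mul2r.
    rewrite (leq_trans _ zW) ?orbT // /W.
    rewrite (leq_trans _ (leq_pmull _ _)) //.
    by rewrite -[X in (X <= _)%N]expn1 leq_pexp2l // !muln_gt0 M0 L0.
  by rewrite mulnA -expnSr -/K -/B.
pose D := (x s.1)%:Z * (t.2.+1)%:Z - (x t.1)%:Z * (s.2.+1)%:Z.
have qD : (q %| `|D|)%N.
  apply/dvdn_partP => // p pq.
  have pw : p \in primes w.
    move: pq; rewrite !mem_primes => /and3P[-> _ pq] /=.
    by rewrite w0 -wE dvdn_mull.
  have zp : (z < p)%N.
    by have := pnatPpi (part_pnat _ w) pq; rewrite !inE -ltnNge.
  have [pp pM pys] := lP p s sS pw; have [_ _ pyt] := lP p t tS pw.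
  have fst : f p s = f p t by apply: st; rewrite mem_filter zp pw.
  have qw : (q`_p %| w)%N.
    by apply: dvdn_trans (dvdn_part _ _) _; exact: dvdn_part.
  (* The full power of p in q divides w, so equality of the root classes modulo p lifts to that
     power; it then divides M D, and p does not divide M. *)
  have := hform_class_lift bez (k := logn p q) (x := (x s.1)%:Z) (x' := (x t.1)%:Z)
    pp pM pys pyt.
  rewrite -p_part; rewrite 2!dvdzE /= -/(val s.1 s.2) -/(val t.1 t.2) vs vt qw.
  have := root_class_eq pp pys pyt fst => -> /(_ isT isT isT).
  have -> : (x s.1)%:Z * (M * t.2.+1)%N%:Z - (x t.1)%:Z * (M * s.2.+1)%N%:Z = M%:Z * D.
    by rewrite /D !PoszM; ring.
  rewrite dvdzE abszM Gauss_dvdr // p_part coprimeXl // prime_coprime //.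
(* D is a difference of two naturals that are at most 2 M A B < q, and q divides it. *)
have {}qD : D = 0.
  apply/eqP; rewrite -absz_eq0; apply: contraTT qbig => D0.
  rewrite -leqNgt (leq_trans (dvdn_leq _ qD)) // ?lt0n //.
  have := x_le (ltn_ord s.1); have := x_le (ltn_ord t.1).
  have := ltn_ord s.2; have := ltn_ord t.2; rewrite /D.
  move: (x s.1) (x t.1) (2 * M * A)%N => a b P ht hs hb ha.
  have := leq_mul ha ht; have := leq_mul hb hs; lia.
have /eqP : (x s.1 * t.2.+1 = x t.1 * s.2.+1)%N.
  by apply/eqP; rewrite -eqz_nat !PoszM -subr_eq0; apply/eqP.
move/eqP => /(proportional_coprime cos cot)[] // xst [yst].
case: s t xst yst {sS tS st cos cot vs vt qD D} => [s1 s2] [t1 t2] /= xst yst.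
congr (_, _); apply/val_inj => //=.
by move: xst; rewrite /xcoord; move: M0; nia.
Qed.

(** There are at least A B / 4 >= B^2 / 4 good points, and at most d^(K d + 1) of them share a
    value. *)
Lemma many_values : exists s : seq int,
  [/\ uniq s, (B ^ 2 <= 4 * d ^ (K * d + 1) * size s)%N &
    {in s, forall m, (`|m| <= C)%N /\ exists x y : int, m = hform d c x y}].
Proof.
exists [seq Posz w | w <- undup [seq val t.1 t.2 | t : 'I_A * 'I_B in good_points]]; split.
- by rewrite map_inj_uniq ?undup_uniq // => ? ? [].
- have := card_le_fibres card_good_fibre; rewrite size_map.
  set k := size _ => gk; rewrite -mulnA (mulnC _ k).
  apply: leq_trans (leq_trans card_good_points _); last by rewrite leq_mul2l gk orbT.
  by rewrite -mulnn leq_mul2r /A leq_pmull ?orbT.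
move=> m /mapP[w]; rewrite mem_undup => /fintype.imageP[t _ ->] ->.
have [h0 /andP[_ hC]] := value_bounds (ltn_ord t.1) (ltn_ord t.2).
split; first exact: hC.
by exists (x t.1)%:Z, (M * t.2.+1)%N%:Z; rewrite /value gez0_abs.
Qed.

End ManyValues.

(** * From values of the monic form to common values *)

Lemma size_le_num_common_values (F1 F2 : bpoly int) N (s : seq int) : uniq s ->
  {in s, forall m, common_values F1 F2 N m} -> (size s <= num_common_values F1 F2 N)%N.
Proof.
move=> us hs; apply: uniq_leq_size us _ => m ms.
by rewrite in_fset_set ?mem_set //; [exact: hs | exact: finite_common_values].
Qed.

(** With B = z^K, about B^2 values of size at most a constant times B^d are produced, which is the
    exponent 2 / d along the sequence N = V z^(K d). *)
Lemma many_common_values d (F1 F2 : bpoly int) : (3 <= d)%N ->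
  Bin_Z d F1 -> Bin_Z d F2 -> form_isomorphic F1 F2 ->
  exists V K K' z0 : nat, [/\ (0 < V)%N, (0 < K)%N, (0 < K')%N &
    forall z N, (z0 <= z)%N -> (V * z ^ (K * d) <= N)%N ->
      (z ^ (2 * K) <= K' * num_common_values F1 F2 N)%N].
Proof.
case: d => [|[|[|n]]] // _ h1 h2 iso.
have [c [a [M [u [v [c0 a0 M0 bez hval]]]]]] := form_reduction h1 h2 iso.
set d := n.+3 in h1 h2 bez hval *; set M' := (6 * `|M|)%N.
(* Multiplying the Bezout identity by 6 times the sign of M makes its constant positive and
   divisible by 6. *)
have bez' : (6 * sgz M)%:P * u * dehom d c + (6 * sgz M)%:P * v * (dehom d c)^`() = (M'%:Z)%:P.
  rewrite -!mulrA -mulrDr bez -polyCM -mulrA -abszEsg.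
  by rewrite /M' PoszM.
have M'0 : (0 < M')%N by rewrite muln_gt0 absz_gt0.
have M'6 : (6 %| M')%N by rewrite dvdn_mulr.
clearbody M'.
set H := (\sum_(k < d.+1) `|c k|)%N; set W := (2 * (2 * M' * (H + 1)) ^ d)%N.
set K := (20 * d).+1.
exists (`|a| * W)%N, K, (4 * d ^ (K * d + 1))%N, (maxn W (K * d + 1)); split.
- by rewrite muln_gt0 absz_gt0 a0 muln_gt0 expn_gt0 !muln_gt0 M'0 addn1.
- by [].
- by rewrite muln_gt0 expn_gt0.
move=> z N; rewrite geq_max => /andP[zW zK] VN.
have [s [us ssize shval]] := many_values c0 bez' M'0 M'6 zW zK.
have inj : injective ( *%R a) by apply: mulfI.
have : (size [seq (a * m)%R | m <- s] <= num_common_values F1 F2 N)%N.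
  apply: size_le_num_common_values; first by rewrite map_inj_uniq.
  move=> _ /mapP[m /shval[mC [x [y mE]]] ->]; split; first by rewrite mE; exact: hval.
  rewrite /= -ler_norml -abszE lez_nat abszM.
  apply: leq_trans VN; rewrite -mulnA leq_mul2l; apply/orP; right.
  by rewrite expnM.
rewrite size_map => sN; rewrite mulnC expnM.
by apply: leq_trans ssize _; rewrite leq_mul2l sN orbT.
Qed.

Unset Implicit Arguments.

Local Open Scope classical_set_scope.

Theorem proposition1p9 (R : realType) (d : nat) (hd : (3 <= d)%N)
    (F1 F2 : bpoly int) (hF1 : Bin_Z d F1) (hF2 : Bin_Z d F2)
    (hiso : form_isomorphic F1 F2) :
  exists C : R, 0 < C /\
    exists e : nat -> R, (e @ \oo --> (0 : R)) /\
      \forall N \near \oo,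
        (C - e N) * N%:R `^ (2 / d%:R) <= (num_common_values F1 F2 N)%:R.
Proof.
have [V [K [K' [z0 [V0 K0 K'0 hV]]]]] := many_common_values hd hF1 hF2 hiso.
have d0 : (0 < d)%N by exact: leq_trans hd.
(* The three losses: V^(2/d) from the constant V, 2^(2 K) from replacing z by 2 z, and K' from
   [many_common_values]. *)
pose D : R := V%:R `^ (2 / d%:R) * 2 ^+ (2 * K) * K'%:R.
have D0 : 0 < D by rewrite !mulr_gt0 ?powR_gt0 ?exprn_gt0 ?ltr0n.
exists D^-1; split; first by rewrite invr_gt0.
(* The inequality holds with the constant [D^-1] itself for all large N, so the error term can be
   0. *)
exists (fun=> 0); split; first exact: cvg_cst.
exists (V * (z0 + 1) ^ (K * d))%N => // N /= NV; rewrite subr0 mulrC ler_pdivrMr //.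
have exP : exists z, (V * z ^ (K * d) <= N)%N by exists (z0 + 1)%N.
have bdP z : (V * z ^ (K * d) <= N)%N -> (z <= N)%N.
  case: z => // z zN; apply: leq_trans zN.
  apply: (@leq_trans (z.+1 ^ (K * d))%N); last by rewrite leq_pmull.
  by rewrite -[leqLHS]expn1 leq_pexp2l // muln_gt0 K0.
have [z zN zmax] := ex_maxnP exP bdP.
have zz0 : (z0 + 1 <= z)%N by exact: zmax.
(* By maximality N < V (z + 1)^(K d), and z + 1 <= 2 z because z >= 1. So interpolating between
   consecutive z costs only a constant factor. *)
have Nz : (N <= V * (2 * z) ^ (K * d))%N.
  apply: (@leq_trans (V * z.+1 ^ (K * d))%N).
    by rewrite leqNgt; apply/negP => /ltnW/zmax; rewrite ltnn.
  by rewrite leq_mul2l leq_exp2r ?muln_gt0 ?K0 //; lia.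
have := hV z N (leq_trans (leq_addr _ _) zz0) zN.
set n := num_common_values _ _ _ => zn.
apply: (@le_trans _ _ ((V * (2 * z) ^ (K * d))%:R `^ (2 / d%:R))).
  by rewrite ge0_ler_powR ?nnegrE ?ler0n ?divr_ge0 ?ler0n ?ler_nat.
rewrite natrM powRM ?ler0n // natrX -powR_mulrn ?ler0n // -powRrM.
have -> : (K * d)%:R * (2 / d%:R) = (2 * K)%:R :> R.
  by rewrite !natrM; field; rewrite pnatr_eq0 -lt0n.
rewrite powR_mulrn ?ler0n // natrM exprMn.
have -> : n%:R * D = V%:R `^ (2 / d%:R) * (2 ^+ (2 * K) * (K'%:R * n%:R)) by rewrite /D; ring.
by rewrite !ler_wpM2l ?powR_ge0 ?exprn_ge0 ?ler0n // -natrX -natrM ler_nat.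
Qed.
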